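(* Let $\Pi=\{0=t_0<\dots<t_n=T\}$ be a partition of $[0,T]$ and let $0\le t\le t_l\in\Pi$. For every couple of NAD-strategies $(\alpha,\beta)\in\mathcal A^\Pi_{t,t_l}\times\mathcal B^\Pi_{t,t_l}$ there exists a unique (up to $dsdP$-a.s. equality) couple of admissible controls $(u,v)\in\mathcal U^\Pi_{t,t_l}\times\mathcal V^\Pi_{t,t_l}$ such that $$\alpha(v)=u,\qquad\beta(u)=v,\qquad dsdP\text{-a.s. on }[t,t_l]\times\Omega.$$
   Context: $T>0$ is fixed and $U,V$ are compact metric spaces. Probability space. $(\Omega,\mathcal F,P)=\big(([0,1]^2)^{\mathbb N},\mathcal B([0,1]^2)^{\otimes\mathbb N},\lambda_2^{\otimes\mathbb N}\big)$, with $\mathbb N$ the positive integers and $\lambda_2$ two-dimensional Lebesgue (Borel) measure on $[0,1]^2$. The coordinate maps are $\zeta_j=(\zeta_{j,1},\zeta_{j,2}):\Omega\to[0,1]^2$, $j\ge1$. Put $\mathcal G_j=\sigma(\zeta_{j,1})$, $\mathcal H_j=\sigma(\zeta_{j,2})$, $\mathcal F_j=\sigma(\zeta_1,\dots,\zeta_j)$ for $j\ge1$, and $\mathcal F_0$ the trivial $\sigma$-field. $\mathbb F=(\mathcal F_j)$; a random time $\tau:\Omega\to\{0,1,2,\dots\}$ is an $\mathbb F$-stopping time if $\{\tau=j\}\in\mathcal F_j$ for all $j\ge0$. Admissible controls. For a sub-$\sigma$-field $\mathcal K\subset\mathcal F$, $L^0_{\mathcal K}(a,b;E)$ denotes the (jointly)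 measurable $E$-valued processes $(u_s)$ on the time interval from $a$ to $b$ with $u_s$ $\mathcal K$-measurable for every $s$. $\mathcal U^\Pi_{0,T}$ is the set of $u\in L^0_{\mathcal F}(0,T;U)$ such that for each $1\le j\le n$, $u|_{[t_{j-1},t_j)}=\sum_{k\ge1}I_{\Gamma_{j,k}}u^{j,k}$ (i.e. $u=u^{j,k}$ on $\Gamma_{j,k}$), where $(\Gamma_{j,k})_{k\ge1}\subset\mathcal F_{j-1}$ is a partition of $\Omega$ and $u^{j,k}\in L^0_{\mathcal G_j}(t_{j-1},t_j;U)$. $\mathcal V^\Pi_{0,T}$ is defined in the same way with $V$ and $\mathcal H_j$ in place of $U$ and $\mathcal G_j$. For $0\le t\le t_l\in\Pi$, $\mathcal U^\Pi_{t,t_l}$ and $\mathcal V^\Pi_{t,t_l}$ are the sets of restrictions of these controls to $[t,t_l]$. NAD-strategies (nonanticipative strategies with delay). $\mathcal B^\Pi_{t,t_l}$ is the set of maps $\beta:\mathcal U^\Pi_{t,t_l}\to\mathcal V^\Pi_{t,t_l}$ such that for every $\mathbb F$-stopping time $\tau:\Omega\to\{0,\dots,n-1\}$ and all $u,u'\in\mathcal U^\Pi_{t,t_l}$ with $u=u'$ $dsdP$-a.s. on $\{(s,\omega):t\le s\le t_{\tau(\omega)}\}$, one has $\beta(u)=\beta(u')$ $dsdP$-a.s. on $\{(s,\omega):t\le s\le t_{\tau(\omega)+1}\}$ (times restricted to $[t,t_l]$). $\mathcal A^\Pi_{t,t_l}$ is the symmetric set of maps $\alpha:\mathcal V^\Pi_{t,t_l}\to\mathcal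 U^\Pi_{t,t_l}$. *)

(* Defs.v *)
From HB Require Import structures.
From mathcomp Require Import all_boot all_order all_algebra.
From mathcomp Require Import all_classical all_reals all_analysis.

Set Implicit Arguments.
Unset Strict Implicit.
Unset Printing Implicit Defensive.

Import Order.TTheory GRing.Theory Num.Theory.
Import numFieldNormedType.Exports.

Local Open Scope classical_set_scope.
Local Open Scope ring_scope.

(* Nonempty metric spaces; `metricType` itself allows the empty space, on which
   the measurability notions of the library are not available. *)
#[short(type="pmetricType")]
HB.structure Definition PMetric (K : numDomainType) :=
  { M of Pointed M & Metric K M }.

Definition borelType (E : ptopologicalType) := g_sigma_algebraType (@open E).

Section sample_space.
Variable R : realType.

Definition square_set : set (R * R) := `[0, 1]%classic `*` `[0, 1]%classic.

Lemma square_set00 : (0, 0) \in square_set.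
Proof. by rewrite inE; split => /=; rewrite in_itv/= lexx ler01. Qed.

(* The sigma-algebra of the square is the trace of the Borel sets of R * R,
   i.e. the preimages of Borel sets under the inclusion. *)
Definition square : Type := set_type square_set.
HB.instance Definition _ := Choice.copy square (set_type square_set).
HB.instance Definition _ := isPointed.Build square (SigSub square_set00).

Definition square_val (x : square) : R * R := \val x.

HB.instance Definition _ := Measurable.copy square
  (g_sigma_algebra_preimageType square_val).

Definition lambda2 (A : set square) : \bar R :=
  (lebesgue_measure \x lebesgue_measure)%E (square_val @` A).

(* Coordinates are numbered from 0, so that `zeta j` is the (j + 1)-th
   coordinate map, attached to the (j + 1)-th interval of the partition. *)
Definition coordinates := nat -> square.

Definition zeta (j : nat) (w : coordinates) : square := w j.
Definition zeta1 (j : nat) (w : coordinates) : R := (square_val (zeta j w)).1.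
Definition zeta2 (j : nat) (w : coordinates) : R := (square_val (zeta j w)).2.

Definition Omega := g_sigma_algebraType
  (\bigcup_j preimage_set_system [set: coordinates] (zeta j) measurable).

(* The rule characterizing the product measure among all probabilities on
   Omega: the cylinders form a pi-system generating its sigma-algebra. *)
Definition is_product_measure (P : probability Omega R) :=
  forall (m : nat) (A : nat -> set square), (forall i, measurable (A i)) ->
    P [set w | forall i, (i < m)%N -> A i (zeta i w)] =
    (\prod_(i < m) lambda2 (A i))%E.

(* sigma-fields of the first and of the second component of `zeta j` *)
Definition sigma_zeta1 (j : nat) : set (set Omega) :=
  g_sigma_algebra_preimage (zeta1 j : Omega -> R).
Definition sigma_zeta2 (j : nat) : set (set Omega) :=
  g_sigma_algebra_preimage (zeta2 j : Omega -> R).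

(* Generated by the first j coordinates; trivial for j = 0. *)
Definition filtration (j : nat) : set (set Omega) :=
  <<s \bigcup_(i in `I_j) preimage_set_system [set: Omega] (zeta i) measurable >>.

Definition stopping_time (tau : Omega -> nat) :=
  forall j, filtration j [set w | tau w = j].

End sample_space.

Section controls.
Variable R : realType.
Local Notation Omega := (Omega R).

(* Only the values at times in [a, b] matter. *)
Definition L0 (E : pmetricType R) (K : set (set Omega)) (a b : R)
    (u : R -> Omega -> E) :=
  measurable_fun (`[a, b]%classic `*` [set: Omega])
    (fun p : R * Omega => u p.1 p.2 : borelType E) /\
  (forall s, s \in `[a, b] -> forall B : set (borelType E), measurable B ->
     K (u s @^-1` B)).

(* The partition Pi is 0 :: s with `itv_partition 0 T s`; it has n = size s
   intervals, and `tp s j` is t_j for j <= n. *)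
Definition tp (s : seq R) (j : nat) : R := nth 0 (0 :: s) j.

(* K j is the sigma-field available on the interval [t_j, t_{j+1}): the one of
   the first component of zeta for one player, of the second for the other.
   Blocks Gamma k may be empty, so finite partitions of Omega are covered. *)
Definition controls (E : pmetricType R) (K : nat -> set (set Omega))
    (T : R) (s : seq R) : set (R -> Omega -> E) :=
  [set u | L0 measurable 0 T u /\
    forall j, (j < size s)%N ->
      exists (Gamma : nat -> set Omega) (uk : nat -> R -> Omega -> E),
      [/\ forall k, filtration j (Gamma k),
          trivIset [set: nat] Gamma /\ \bigcup_k Gamma k = [set: Omega],
          forall k, L0 (K j) (tp s j) (tp s j.+1) (uk k) &
          forall k x w, x \in `[tp s j, tp s j.+1[ -> Gamma k w ->
            u x w = uk k x w]].

Definition process (E : Type) (a b : R) := `[a, b]%classic -> Omega -> E.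

Definition controls_on (E : pmetricType R) (K : nat -> set (set Omega))
    (T : R) (s : seq R) (a b : R) : set (process E a b) :=
  [set sigL `[a, b]%classic u | u in controls K T s].

(* u = u' dsdP-a.s. on the pairs (x, w) with x in [a, b] lying in S *)
Definition dsdP_eq_on (E : Type) (P : probability Omega R) (a b : R)
    (S : set (R * Omega)) (u u' : process E a b) :=
  \forall p \ae (lebesgue_measure \x P)%E, S p ->
    forall h : p.1 \in `[a, b]%classic, u (SigSub h) p.2 = u' (SigSub h) p.2.

(* The constraint a <= x is part of the type of processes.  A strategy is a
   map from CE to CF; its values outside CE are irrelevant. *)
Definition NAD_strategy (E F : Type) (P : probability Omega R) (s : seq R)
    (a b : R) (CE : set (process E a b)) (CF : set (process F a b)) :
    set (process E a b -> process F a b) :=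
  [set beta | set_fun CE CF beta /\
    forall tau : Omega -> nat, stopping_time tau ->
      (forall w, (tau w < size s)%N) ->
    forall u u', CE u -> CE u' ->
      dsdP_eq_on P [set p | p.1 <= tp s (tau p.2)] u u' ->
      dsdP_eq_on P [set p | p.1 <= tp s (tau p.2).+1] (beta u) (beta u')].

Definition dsdP_eq (E : Type) (P : probability Omega R) (a b : R)
    (u u' : process E a b) := dsdP_eq_on P setT u u'.

End controls.

Arguments controls_on {R} E K T s a b _.

(* Main.v *)
Require Import Defs.
From HB Require Import structures.
From mathcomp Require Import all_boot all_order all_algebra.
From mathcomp Require Import all_classical all_reals all_analysis.
Import Order.TTheory GRing.Theory Num.Theory.
Import numFieldNormedType.Exports.
Local Open Scope classical_set_scope.
Local Open Scope ring_scope.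

(** A delay strategy contracts ignorance: if two controls agree almost
everywhere up to time t_j, the responses to them agree almost everywhere up to
the next grid time t_{j+1} (apply the defining property to the stopping time
constantly equal to j; [NAD_strategy_advance]).  Hence the map
(u, v) |-> (alpha v, beta u), whose fixed points modulo null sets are the
couples sought, gains one interval of agreement at each application.  Any two
controls agree up to t_0 = 0, because only the null set {0} x Omega is
concerned ([dsdP_eq_upto0]), so that after l applications agreement holds on
the whole interval [t, t_l].

This gives both assertions.  Two fixed points agree up to t_j for every j, by
induction on j.  For existence, iterate the map from any couple of admissible
controls, for instance a constant one ([cst_controls]): the j-th and the
(j+1)-th iterates agree up to t_j, so the l-th iterate is a fixed point modulo
null sets. *)

Section agreement.
Set Implicit Arguments.
Unset Strict Implicit.
Variables (R : realType) (P : probability (Omega R) R) (E : Type) (a b : R).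
Implicit Types (S : set (R * Omega R)) (u v w : process E a b).

Definition dsdP_eq_upto (c : R) u v := dsdP_eq_on P [set p | p.1 <= c] u v.

#[local] Instance ae_dsdP_filter :
  Filter (nbhs (almost_everywhere (lebesgue_measure \x P)%E)).
Proof. exact: ae_filter_ringOfSetsType. Qed.

Lemma dsdP_eq_on_sym S u v : dsdP_eq_on P S u v -> dsdP_eq_on P S v u.
Proof. by apply: filterS => p uv Sp h; rewrite uv. Qed.

Lemma dsdP_eq_on_trans S u v w :
  dsdP_eq_on P S u v -> dsdP_eq_on P S v w -> dsdP_eq_on P S u w.
Proof. by apply: filterS2 => p uv vw Sp h; rewrite uv// vw. Qed.

Lemma dsdP_eqW S u v : dsdP_eq P u v -> dsdP_eq_on P S u v.
Proof. by apply: filterS => p uv _; exact: uv. Qed.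

Lemma dsdP_eq_upto_end u v : dsdP_eq_upto b u v -> dsdP_eq P u v.
Proof.
apply: filterS => p uv _ h; apply: uv => /=.
by move: (h); rewrite inE/= in_itv/= => /andP[].
Qed.

(** Within a nonnegative time interval, the times up to 0 reduce to the single
instant 0, which is negligible. *)
Lemma dsdP_eq_upto0 u v : 0 <= a -> dsdP_eq_upto 0 u v.
Proof.
move=> a0; exists ([set 0] `*` setT); split.
- exact: measurableX.
- rewrite product_measure1E// -[RHS](mul0e (P setT)).
  by congr (_ * _)%E; exact: lebesgue_measure_set1.
- move=> [x w] /= /not_implyP[x0] /existsNP[h _]; split => //=.
  apply/eqP; rewrite eq_le x0/=; apply: le_trans a0 _.
  by move: (h); rewrite inE/= in_itv/= => /andP[].
Qed.

End agreement.

Section strategies.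
Set Implicit Arguments.
Unset Strict Implicit.
Variable R : realType.

Lemma sigma_algebraT (Om : Type) (K : set (set Om)) :
  sigma_algebra setT K -> K setT.
Proof. by move=> [K0 KC _]; rewrite -[setT]setD0; exact: KC. Qed.

Lemma sigma_algebra_cst (Om X : Type) (K : set (set Om)) (c : X) (B : set X) :
  sigma_algebra setT K -> K (cst c @^-1` B).
Proof.
move=> sK; rewrite preimage_cst; case: ifP => _; first exact: sigma_algebraT.
by case: sK.
Qed.

Lemma sigma_algebra_filtration (j : nat) :
  sigma_algebra setT (@filtration R j).
Proof. exact: smallest_sigma_algebra. Qed.

Lemma stopping_time_cst (j : nat) : @stopping_time R (cst j).
Proof.
by move=> i; exact: (sigma_algebra_cst _ [set i] (sigma_algebra_filtration i)).
Qed.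

(** The gain of one interval comes from the delay: the response on the interval
that starts at t_j depends only on what happened before t_j. *)
Lemma NAD_strategy_advance (P : probability (Omega R) R) (s : seq R)
    (E F : Type) (a b : R) (CE : set (process E a b)) (CF : set (process F a b))
    beta (j : nat) u u' :
  NAD_strategy P s CE CF beta -> (j < size s)%N -> CE u -> CE u' ->
  dsdP_eq_upto P (tp s j) u u' ->
  dsdP_eq_upto P (tp s j.+1) (beta u) (beta u').
Proof.
by move=> [_ delay] js; exact: delay (stopping_time_cst j) (fun=> js) _ _.
Qed.

Lemma L0_cst (E : pmetricType R) (K : set (set (Omega R))) (a b : R) (e : E) :
  sigma_algebra setT K -> L0 K a b (fun _ _ => e).
Proof.
move=> sK; split=> [|x _ B _]; last exact: sigma_algebra_cst.
by apply: measurable_cst; apply: measurableX.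
Qed.

Lemma cst_controls (E : pmetricType R) (K : nat -> set (set (Omega R)))
    (T : R) (s : seq R) (e : E) :
  (forall j, sigma_algebra setT (K j)) -> controls K T s (fun _ _ => e).
Proof.
move=> sK; split=> [|j _]; first exact/L0_cst/sigma_algebra_measurable.
have sF := sigma_algebra_filtration j.
(* The trivial partition of Omega, completed by empty blocks. *)
exists (fun k => if k == 0%N then setT else set0), (fun _ _ _ => e); split=> //.
- by move=> [|k] /=; [exact: sigma_algebraT | case: sF].
- split; last by rewrite -subTset => w _; exists 0%N.
  by apply/trivIsetP => -[|i] [|k] //= _ _ _; rewrite ?setI0 ?set0I.
- by move=> k; exact: L0_cst.
Qed.

End strategies.

Theorem lemma2p2 (R : realType) (T : R) (hT : 0 < T)
  (U V : pmetricType R) (hU : compact [set: U]) (hV : compact [set: V])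
  (P : probability (Omega R) R) (hP : is_product_measure P)
  (s : seq R) (hs : itv_partition 0 T s)
  (t : R) (l : nat) (hl : (l <= size s)%N) (h0t : 0 <= t) (htl : t <= tp s l)
  (alpha : process V t (tp s l) -> process U t (tp s l))
  (beta : process U t (tp s l) -> process V t (tp s l)) :
  let UPi := controls_on U (@sigma_zeta1 R) T s t (tp s l) in
  let VPi := controls_on V (@sigma_zeta2 R) T s t (tp s l) in
  NAD_strategy P s VPi UPi alpha ->
  NAD_strategy P s UPi VPi beta ->
  exists u v,
    [/\ UPi u, VPi v, dsdP_eq P (alpha v) u & dsdP_eq P (beta u) v] /\
    forall u' v', UPi u' -> VPi v' ->
      dsdP_eq P (alpha v') u' -> dsdP_eq P (beta u') v' ->
      dsdP_eq P u' u /\ dsdP_eq P v' v.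
Proof.
move=> UPi VPi NADa NADb.
have sub_alpha v : VPi v -> UPi (alpha v) by case: NADa => + _; exact.
have sub_beta u : UPi u -> VPi (beta u) by case: NADb => + _; exact.
have [u0 UPiu0] : exists u, UPi u.
  eexists; exists (fun _ _ => point) => //; apply: cst_controls => j.
  exact/sigma_algebra_preimage/sigma_algebra_measurable.
have [v0 VPiv0] : exists v, VPi v.
  eexists; exists (fun _ _ => point) => //; apply: cst_controls => j.
  exact/sigma_algebra_preimage/sigma_algebra_measurable.
pose it k := iter k (fun p => (alpha p.2, beta p.1)) (u0, v0).
have itP k : UPi (it k).1 /\ VPi (it k).2.
  by elim: k => //= k [iu iv]; split; [exact: sub_alpha | exact: sub_beta].
have it_upto j : (j <= l)%N ->
    dsdP_eq_upto P (tp s j) (it j.+1).1 (it j).1 /\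
    dsdP_eq_upto P (tp s j) (it j.+1).2 (it j).2.
  elim: j => [_|j IH jl]; first by split; exact: dsdP_eq_upto0.
  have [Uj Vj] := itP j; have [Uj1 Vj1] := itP j.+1.
  have [eu ev] := IH (ltnW jl); have js := leq_trans jl hl.
  by split; [exact: NAD_strategy_advance NADa _ _ _ ev
           | exact: NAD_strategy_advance NADb _ _ _ eu].
have [UPiu VPiv] := itP l; have [eu ev] := it_upto l (leqnn l).
exists (it l).1, (it l).2; split.
  by split=> //; exact: dsdP_eq_upto_end.
move=> u' v' UPiu' VPiv' au' bv'.
(* Both couples are fixed points only up to null sets, hence the detour
   u' ~ alpha v' ~ alpha v ~ u, whose middle step alone is limited in time. *)
suff /(_ l (leqnn l))[eu' ev'] : forall j, (j <= l)%N ->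
    dsdP_eq_upto P (tp s j) u' (it l).1 /\
    dsdP_eq_upto P (tp s j) v' (it l).2.
  by split; exact: dsdP_eq_upto_end.
elim=> [_|j IH jl]; first by split; exact: dsdP_eq_upto0.
have [eu' ev'] := IH (ltnW jl); have js := leq_trans jl hl.
split.
- apply: dsdP_eq_on_trans (dsdP_eq_on_sym (dsdP_eqW _ au')) _.
  apply: dsdP_eq_on_trans (dsdP_eqW _ (dsdP_eq_upto_end eu)).
  exact: NAD_strategy_advance NADa _ _ _ ev'.
- apply: dsdP_eq_on_trans (dsdP_eq_on_sym (dsdP_eqW _ bv')) _.
  apply: dsdP_eq_on_trans (dsdP_eqW _ (dsdP_eq_upto_end ev)).
  exact: NAD_strategy_advance NADb _ _ _ eu'.
Qed.
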